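(* Let $A$ be a locally $C^*$-algebra and let $E$ and $F$ be Hilbert $A$-modules. Then $E$ and $F$ are unitarily equivalent (as Hilbert $A$-modules) if and only if $b(E)$ and $b(F)$ are unitarily equivalent (as Hilbert $b(A)$-modules).
   Context: A locally $C^*$-algebra is a complete Hausdorff complex topological $*$-algebra $A$ whose topology is determined by its continuous $C^*$-seminorms: a net $(a_i)$ converges to $0$ iff $p(a_i)\to 0$ for every continuous $C^*$-seminorm $p$. $S(A)$ denotes the set of all continuous $C^*$-seminorms on $A$. The set of bounded elements $b(A)=\{a\in A: \|a\|_\infty=\sup_{p\in S(A)}p(a)<\infty\}$ is a $C^*$-algebra with norm $\|\cdot\|_\infty$. A pre-Hilbert $A$-module is a complex vector space $E$ that is also a right $A$-module (compatible with the complex algebra structure), with an $A$-valued inner product $\langle\cdot,\cdot\rangle:E\times E\to A$ that is $\mathbb{C}$- and $A$-linear in the second variable and satisfies $\langle\xi,\eta\rangle^*=\langle\eta,\xi\rangle$, $\langle\xi,\xi\rangle\ge 0$, and $\langle\xi,\xi\rangle=0$ iff $\xi=0$. It is a Hilbert $A$-module if it is complete for the topology given by the seminorms $\overline{p}_E(\xi)=\sqrt{p(\langle\xi,\xi\rangle)}$, $p\in S(A)$. The set of bounded elements $b(E)=\{\xi\in E:\|\xi\|_\infty=\sup_{p\in S(A)}\overline{p}_E(\xi)<\infty\}$ is a Hilbert $C^*$-module over $b(A)$ with the restricted operations and inner product. $L_A(E,F)$ is the set of adjointable $A$-module homomorphisms $E\to F$. $U\in L_A(E,F)$ is unitary if $U^*U=\mathrm{id}_E$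 and $UU^*=\mathrm{id}_F$. $E$ and $F$ are unitarily equivalent if there is a unitary operator in $L_A(E,F)$; the same definitions apply over the $C^*$-algebra $b(A)$. *)

(* Defs.v *)
From HB Require Import structures.
From mathcomp Require Import all_boot all_order all_algebra.
From mathcomp Require Import complex.
From mathcomp Require Import all_classical all_reals all_analysis.
Import Order.TTheory GRing.Theory Num.Theory.
Import numFieldTopology.Exports numFieldNormedType.Exports.

Set Implicit Arguments.
Unset Strict Implicit.
Unset Printing Implicit Defensive.

Local Open Scope classical_set_scope.
Local Open Scope complex_scope.
Local Open Scope ring_scope.

(* MathComp rings are unital, but *-algebras need not be: the product is an
   extra operation on a complex vector space. *)
HB.mixin Record isStarAlgebra (R : realType) A & GRing.Lmodule R[i] A := {
  amul : A -> A -> A;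
  star : A -> A;
  amulA : forall a b c, amul a (amul b c) = amul (amul a b) c;
  amulDl : forall a b c, amul (a + b) c = amul a c + amul b c;
  amulDr : forall a b c, amul a (b + c) = amul a b + amul a c;
  amulZl : forall (z : R[i]) a b, amul (z *: a) b = z *: amul a b;
  amulZr : forall (z : R[i]) a b, amul a (z *: b) = z *: amul a b;
  starK : forall a, star (star a) = a;
  starD : forall a b, star (a + b) = star a + star b;
  starZ : forall (z : R[i]) a, star (z *: a) = z^*%C *: star a;
  starM : forall a b, star (amul a b) = amul (star b) (star a)
}.

#[short(type="starAlgType")]
HB.structure Definition StarAlgebra (R : realType) :=
  {A of GRing.Lmodule R[i] A & isStarAlgebra R A}.

Definition positive (R : realType) (A : starAlgType R) (a : A) : Prop :=
  exists b : A, a = amul (star b) b.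

(* Nonnegativity of p and p (star a) = p a follow from these axioms. *)
Definition cstar_seminorm (R : realType) (A : starAlgType R) (p : A -> R) :=
  [/\ forall a b, p (a + b) <= p a + p b,
      forall (z : R[i]) a, p (z *: a) = complex.Re `|z| * p a,
      forall a b, p (amul a b) <= p a * p b &
      forall a, p (amul (star a) a) = p a ^+ 2].

#[short(type="topStarAlgType")]
HB.structure Definition TopStarAlgebra (R : realType) :=
  {A of StarAlgebra R A & Tvs R[i] A}.

(* S(A) *)
Definition cont_seminorms (R : realType) (A : topStarAlgType R)
    : set (A -> R) :=
  [set p | cstar_seminorm p /\ continuous p].

(* A Tvs carries a uniform structure inducing its topology but not tied to
   addition.  sub_unif_locCstar forces it to be the one of the topological
   group (A, +), so that Cauchy filters are those of the topological vector
   space A.  The local convexity demanded by Tvs is no restriction here, as it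
   follows from cvg0_locCstar. *)
HB.mixin Record isLocallyCstar (R : realType) A & TopStarAlgebra R A := {
  amul_continuous : continuous (fun ab : A * A => amul ab.1 ab.2);
  star_continuous : continuous (star : A -> A);
  sub_unif_locCstar : unif_continuous (fun ab : A * A => ab.1 - ab.2);
  hausdorff_locCstar : hausdorff_space A;
  complete_locCstar : forall G : set_system A, ProperFilter G -> cauchy G ->
    exists a : A, G --> a;
  cvg0_locCstar : forall G : set_system A, ProperFilter G ->
    (G --> (0 : A)) <->
    (forall p : A -> R, cont_seminorms p -> p @ G --> (0 : R))
}.

#[short(type="locCstarAlgType")]
HB.structure Definition LocCstarAlgebra (R : realType) :=
  {A of TopStarAlgebra R A & isLocallyCstar R A}.

HB.mixin Record isPreHilbertModule (R : realType) (A : locCstarAlgType R) E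
    & GRing.Lmodule R[i] E := {
  ract : E -> A -> E;
  inner : E -> E -> A;
  ractA : forall x a b, ract x (amul a b) = ract (ract x a) b;
  ractDl : forall x y a, ract (x + y) a = ract x a + ract y a;
  ractDr : forall x a b, ract x (a + b) = ract x a + ract x b;
  ractZl : forall (z : R[i]) x a, ract (z *: x) a = z *: ract x a;
  ractZr : forall (z : R[i]) x a, ract x (z *: a) = z *: ract x a;
  innerDr : forall x y y', inner x (y + y') = inner x y + inner x y';
  innerZr : forall (z : R[i]) x y, inner x (z *: y) = z *: inner x y;
  inner_ract : forall x y a, inner x (ract y a) = amul (inner x y) a;
  star_inner : forall x y, star (inner x y) = inner y x;
  inner_pos : forall x, positive (inner x x);
  inner_eq0 : forall x, inner x x = 0 <-> x = 0
}.

#[short(type="preHilbertModType")]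
HB.structure Definition PreHilbertModule (R : realType)
    (A : locCstarAlgType R) :=
  {E of GRing.Lmodule R[i] E & isPreHilbertModule R A E}.

Definition hbar (R : realType) (A : locCstarAlgType R)
    (E : preHilbertModType A) (p : A -> R) (x : E) : R :=
  Num.sqrt (p (inner x x)).

HB.mixin Record isHilbertModule (R : realType) (A : locCstarAlgType R) E
    & PreHilbertModule R A E := {
  hilbert_complete : forall G : set_system E, ProperFilter G ->
    (forall (p : A -> R) (e : R), cont_seminorms p -> 0 < e ->
       exists2 X : set E, G X &
         forall x y, X x -> X y -> hbar p (x - y) < e) ->
    exists x : E, forall p : A -> R, cont_seminorms p ->
      hbar p (y - x) @[y --> G] --> (0 : R)
}.

#[short(type="hilbertModType")]
HB.structure Definition HilbertModule (R : realType)
    (A : locCstarAlgType R) :=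
  {E of PreHilbertModule R A E & isHilbertModule R A E}.

Section Bounded.
Variables (R : realType) (A : locCstarAlgType R).

Definition norm_infty (a : A) : \bar R :=
  ereal_sup [set (p a)%:E | p in cont_seminorms (A := A)].

Definition bounded_elts : set A := [set a | (norm_infty a < +oo)%E].

Definition mod_norm_infty (E : hilbertModType A) (x : E) : \bar R :=
  ereal_sup [set (hbar p x)%:E | p in cont_seminorms (A := A)].

Definition mod_bounded_elts (E : hilbertModType A) : set E :=
  [set x | (mod_norm_infty x < +oo)%E].

End Bounded.
Arguments bounded_elts {R} A.
Arguments mod_bounded_elts {R A} E.

(* The notions below are relative to a *-subalgebra B of A and to subsets M of E
   and N of F that are B-modules for the restricted operations, with B-valued
   restricted inner product.  The two cases of interest are the modules E and F
   over A (B, M, N are the full sets) and b(E) and b(F) over b(A).  Operators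
   M -> N are given by functions E -> F; their values off M are irrelevant. *)
Section Operators.
Variables (R : realType) (A : locCstarAlgType R) (E F : hilbertModType A).
Variables (B : set A) (M : set E) (N : set F).

Definition module_hom (U : E -> F) : Prop :=
  [/\ forall x, M x -> N (U x),
      forall x y, M x -> M y -> U (x + y) = U x + U y,
      forall (z : R[i]) x, M x -> U (z *: x) = z *: U x &
      forall x a, M x -> B a -> U (ract x a) = ract (U x) a].

Definition is_adjoint (U : E -> F) (V : F -> E) : Prop :=
  (forall y, N y -> M (V y)) /\
  (forall x y, M x -> N y -> inner (U x) y = inner x (V y)).

(* L_B(M, N) *)
Definition adjointable_homs : set (E -> F) :=
  [set U | module_hom U /\ exists V, is_adjoint U V].

Definition unitary (U : E -> F) : Prop :=
  adjointable_homs U /\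
  exists V, [/\ is_adjoint U V,
                forall x, M x -> V (U x) = x &
                forall y, N y -> U (V y) = y].

Definition unitarily_equivalent : Prop := exists U : E -> F, unitary U.

End Operators.

(* Main.v *)
(* A unitary E -> F preserves all seminorms, hence restricts to bounded elements.
   Conversely b(E) is dense in E: for h = <x,x> = c k the element
   x (1 + i k)^-1 is bounded and tends to x as c tends to infinity.  A unitary
   U : b(E) -> b(F) preserves inner products, so the closure of its graph is the
   graph of a map E -> F; it preserves inner products and has as adjoint and
   inverse the map obtained from U^-1, and adjointable maps are module maps.

   All estimates are made for one continuous C*-seminorm p at a time, inside A,
   without functional calculus.  The triangle and Cauchy-Schwarz inequalities in
   E are only needed up to constants, and follow from
   p(a' a) <= C p(a' a + b' b), where a' is the adjoint of a. *)
From HB Require Import structures.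
Require Import Defs.
From mathcomp Require Import all_boot all_order all_algebra.
From mathcomp Require Import complex ring lra.
From mathcomp Require Import all_classical all_reals all_analysis.
Import Order.TTheory GRing.Theory Num.Theory.
Import numFieldTopology.Exports numFieldNormedType.Exports.

Set Implicit Arguments.
Unset Strict Implicit.
Unset Printing Implicit Defensive.

Local Open Scope classical_set_scope.
Local Open Scope complex_scope.
Local Open Scope ring_scope.

Local Notation "a ** b" := (amul a b) (at level 40, left associativity).

(** * Identities in modules and *-algebras *)

Section LinearCombinations.
Variables (K : nzRingType) (V : lmodType K).

(** Syntax for proof by reflection. Atoms are indices into a list of vectors; scalars are not
    reified, so equations between coefficients are left to [ring]. *)
Inductive lincomb : Type :=
| LAtom of nat
| LZero
| LAdd of lincomb & lincomb
| LOpp of lincomb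
| LScale of K & lincomb.

Fixpoint lincomb_eval (e : seq V) (t : lincomb) : V :=
  match t with
  | LAtom n => nth 0 e n
  | LZero => 0
  | LAdd t u => lincomb_eval e t + lincomb_eval e u
  | LOpp t => - lincomb_eval e t
  | LScale c t => c *: lincomb_eval e t
  end.

Fixpoint lincomb_coef (t : lincomb) (i : nat) : K :=
  match t with
  | LAtom n => if eqn n i then 1 else 0
  | LZero => 0
  | LAdd t u => lincomb_coef t i + lincomb_coef u i
  | LOpp t => - lincomb_coef t i
  | LScale c t => c * lincomb_coef t i
  end.

Fixpoint all_lt (n : nat) (P : nat -> Prop) : Prop :=
  if n is m.+1 then P m /\ all_lt m P else True.

Lemma lincomb_evalE e t :
  lincomb_eval e t = \sum_(i < size e) lincomb_coef t i *: nth 0 e i.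
Proof.
elim: t => [n||t IHt u IHu|t IHt|c t IHt] /=.
- case: (ltnP n (size e)) => [n_lt|n_ge].
    rewrite (bigD1 (Ordinal n_lt)) //= big1 ?addr0.
      by case: eqnP => // _; rewrite scale1r.
    move=> i; rewrite -val_eqE /=; case: eqnP => [->|]; first by rewrite eqxx.
    by rewrite scale0r.
  rewrite nth_default// big1 // => i _; case: eqnP => [ni|].
    by move: (ltn_ord i); rewrite -ni ltnNge n_ge.
  by rewrite scale0r.
- by rewrite big1 // => i _; rewrite scale0r.
- by rewrite IHt IHu -big_split /=; apply: eq_bigr => i _; rewrite scalerDl.
- by rewrite IHt -sumrN; apply: eq_bigr => i _; rewrite scaleNr.
- by rewrite IHt scaler_sumr; apply: eq_bigr => i _; rewrite scalerA.
Qed.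

Lemma lincomb_eq e t u :
  all_lt (size e) (fun i => lincomb_coef t i = lincomb_coef u i) ->
  lincomb_eval e t = lincomb_eval e u.
Proof.
move=> eq_tu; rewrite !lincomb_evalE; apply: eq_bigr => i _; congr (_ *: _).
case: i => i /=; elim: (size e) eq_tu => //= n IHn [eq_n /IHn eq_lt].
by rewrite ltnS leq_eqVlt => /predU1P[->|/eq_lt].
Qed.

End LinearCombinations.

Ltac lincomb_index x e :=
  lazymatch e with
  | x :: _ => constr:(0%N)
  | _ :: ?e' => let n := lincomb_index x e' in constr:(n.+1)
  end.
Ltac lincomb_insert x e :=
  match e with
  | _ => let _ := lincomb_index x e in e
  | _ => constr:(x :: e)
  end.
Ltac lincomb_atoms t e :=
  lazymatch t with
  | @GRing.add _ ?a ?b => let e1 := lincomb_atoms a e in lincomb_atoms b e1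
  | @GRing.opp _ ?a => lincomb_atoms a e
  | @GRing.scale _ _ _ ?a => lincomb_atoms a e
  | @GRing.zero _ => e
  | _ => lincomb_insert t e
  end.
Ltac lincomb_reify K t e :=
  lazymatch t with
  | @GRing.add _ ?a ?b =>
      let a' := lincomb_reify K a e in
      let b' := lincomb_reify K b e in constr:(LAdd a' b')
  | @GRing.opp _ ?a => let a' := lincomb_reify K a e in constr:(LOpp a')
  | @GRing.scale _ _ ?c ?a =>
      let a' := lincomb_reify K a e in constr:(@LScale K c a')
  | @GRing.zero _ => constr:(LZero K)
  | _ => let n := lincomb_index t e in constr:(LAtom K n)
  end.
(* Reduces an equation between linear combinations of arbitrary vectors to the
   equations between the coefficients. *)
Ltac lmodule_eq K V :=
  lazymatch goal with
  | |- @eq _ ?t ?u =>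
      let e0 := lincomb_atoms t (@nil (GRing.Lmodule.sort V)) in
      let e := lincomb_atoms u e0 in
      let t' := lincomb_reify K t e in
      let u' := lincomb_reify K u e in
      change (@lincomb_eval K V e t' = @lincomb_eval K V e u');
      apply: lincomb_eq; cbn [size lincomb_coef all_lt eqn]; repeat split
  end.

Section StarAlgebras.
Variables (R : realType) (A : starAlgType R).
Implicit Types (a b x y : A) (z : R[i]).

Lemma mulCi : 'i%C * 'i%C = -1 :> R[i]. Proof. by rewrite -expr2 sqr_i. Qed.

Lemma amulNl a b : (- a) ** b = - (a ** b).
Proof. by rewrite -scaleN1r amulZl scaleN1r. Qed.

Lemma amulNr a b : a ** (- b) = - (a ** b).
Proof. by rewrite -scaleN1r amulZr scaleN1r. Qed.

Lemma starN a : star (- a) = - star a.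
Proof. by rewrite -scaleN1r starZ rmorphN1 scaleN1r. Qed.

Lemma starZr (r : R) a : star (r%:C *: a) = r%:C *: star a.
Proof. by rewrite starZ conjc_real. Qed.

Lemma starZi a : star ('i%C *: a) = - ('i%C *: star a).
Proof. by rewrite starZ -scaleNr; congr (_ *: _); simpc. Qed.

(** Rewriting with these rules yields a linear combination of words in atoms and their adjoints, as
    [lmodule_eq] needs. *)
Definition star_expand := (@amulDl R A, @amulDr R A, amulNl, amulNr,
  @amulZl R A, @amulZr R A, @starD R A, starN, starZr, starZi, @starM R A,
  @starK R A, @amulA R A).

End StarAlgebras.

(** * Positivity with respect to a C*-seminorm *)

Section CstarSeminorm.
Variables (R : realType) (A : starAlgType R) (p : A -> R).
Hypothesis hp : cstar_seminorm p.
Implicit Types (a b x y h k q : A) (r t : R).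

Lemma cseminormD a b : p (a + b) <= p a + p b. Proof. by case: hp. Qed.

Lemma cseminormM a b : p (a ** b) <= p a * p b. Proof. by case: hp. Qed.

Lemma cseminorm_star_mul a : p (star a ** a) = p a ^+ 2.
Proof. by case: hp. Qed.

Lemma cseminormZr r a : p (r%:C *: a) = `|r| * p a.
Proof.
by case: hp => _ -> _ _; rewrite normc_def /= expr0n addr0 sqrtr_sqr.
Qed.

Lemma cseminormZi a : p ('i%C *: a) = p a.
Proof.
by case: hp => _ -> _ _; rewrite normc_def /= expr0n expr1n add0r sqrtr1 mul1r.
Qed.

Lemma cseminormN a : p (- a) = p a.
Proof.
have -> : - a = (-1)%:C *: a by lmodule_eq R[i] A; ring.
by rewrite cseminormZr normrN1 mul1r.
Qed.

Lemma cseminorm0 : p 0 = 0.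
Proof. by rewrite -(scale0r 0) (cseminormZr 0 0) normr0 mul0r. Qed.

Lemma cseminorm_ge0 a : 0 <= p a.
Proof.
have := cseminormD a (- a); rewrite subrr cseminorm0 cseminormN.
by rewrite -mulr2n pmulrn_lge0.
Qed.

Lemma cseminormB a b : p (a - b) <= p a + p b.
Proof. by rewrite -(cseminormN b) cseminormD. Qed.

Lemma cseminorm_star a : p (star a) = p a.
Proof.
have le_star b : p b <= p (star b).
  have [/eqP ->|nz] := boolP (p b == 0); first exact: cseminorm_ge0.
  have pb_gt0 : 0 < p b by rewrite lt_def nz cseminorm_ge0.
  by rewrite -(ler_pM2r pb_gt0) -expr2 -cseminorm_star_mul cseminormM.
by apply/le_anti; rewrite le_star -{2}(starK a) le_star.
Qed.

Lemma cseminorm_mul_star a : p (a ** star a) = p a ^+ 2.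
Proof. by rewrite -{1}(starK a) cseminorm_star_mul cseminorm_star. Qed.

(** Write x' for the adjoint of x and put [y := x + a x]. For skew [a] the terms x' a x and x' a' x
    cancel, so 2 x' x = x' y + y' x; in seminorms, [p x ^+ 2 <= p x * p y]. *)
Lemma cseminorm_le_skew a x : star a = - a -> p x <= p (x + a ** x).
Proof.
move=> skew_a; set y := x + a ** x.
have eq_y : (2 : R)%:C *: (star x ** x) = star x ** y + star y ** x.
  rewrite /y !star_expand skew_a !star_expand; lmodule_eq R[i] A; ring.
have le_y : 2 * p x ^+ 2 <= 2 * (p x * p y).
  rewrite -cseminorm_star_mul -(ger0_norm (ler0n R 2)) -cseminormZr eq_y.
  apply: (le_trans (cseminormD _ _)); rewrite ger0_norm // mulr_natl mulr2n.
  by apply: lerD; apply: (le_trans (cseminormM _ _));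
    rewrite cseminorm_star // mulrC.
have := cseminorm_ge0 x; rewrite le_eqVlt => /predU1P[<-|px_gt0].
  exact: cseminorm_ge0.
by move: le_y; rewrite ler_pM2l // expr2 ler_pM2l.
Qed.

(* For self-adjoint [h] this says that the spectrum of the image of [h] in the
   C*-algebra of [p] is nonnegative; unlike [positive], it is visibly closed
   under addition. *)
Definition accretive h := forall t x, 0 <= t -> p x <= p (x + t%:C *: (h ** x)).

(** 1 + t k^2 = (1 + a) (1 - a) for a = i sqrt(t) k, and both a and -a are skew. *)
Lemma accretive_sqr k : star k = k -> accretive (k ** k).
Proof.
move=> sa_k t x t_ge0.
pose s := Num.sqrt t; pose a := s%:C *: ('i%C *: k).
have skew a' : a' = a \/ a' = - a -> star a' = - a'.
  by case=> ->; rewrite /a !star_expand sa_k; lmodule_eq R[i] A; ring.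
have -> : x + t%:C *: (k ** k ** x) = (x - a ** x) + a ** (x - a ** x).
  rewrite /a !star_expand -(sqr_sqrtr t_ge0) -/s.
  lmodule_eq R[i] A; ring: (@mulCi R).
apply: le_trans (cseminorm_le_skew (x - a ** x) (skew a _)); last by left.
by rewrite -amulNl; apply: cseminorm_le_skew; apply: skew; right.
Qed.

(** As (1 + t h) (1 - t h) = 1 - t^2 h^2, accretivity applied to x - t h x leaves growth of second
    order in t only; [accretiveD] depends on this. *)
Lemma accretive_sub_le h t x : accretive h -> 0 <= t ->
  p (x - t%:C *: (h ** x)) <= (1 + t ^+ 2 * p h ^+ 2) * p x.
Proof.
move=> acc_h t_ge0; apply: (le_trans (acc_h t _ t_ge0)).
have -> : x - t%:C *: (h ** x) + t%:C *: (h ** (x - t%:C *: (h ** x))) =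
          x - (t ^+ 2)%:C *: (h ** (h ** x)).
  by rewrite !star_expand; lmodule_eq R[i] A; ring.
apply: (le_trans (cseminormB _ _)); rewrite mulrDl mul1r lerD2l.
rewrite cseminormZr ger0_norm ?sqr_ge0 // -mulrA ler_wpM2l ?sqr_ge0 //.
apply: (le_trans (cseminormM _ _)); rewrite expr2 -mulrA.
by rewrite ler_wpM2l ?cseminorm_ge0 // cseminormM.
Qed.

(** The vector v = x - t (h + k) x is the mean of x - 2 t h x and x - 2 t k x, so [p v] is at most
    (1 + O(t^2)) [p x]. Then (t + s) x = t y + s v bounds [p x] by [p y] + O(t), and t tends to
    0. *)
Lemma accretiveD h k : accretive h -> accretive k -> accretive (h + k).
Proof.
move=> acc_h acc_k s x s_ge0; set y := x + _.
pose c := 2 * (p h ^+ 2 + p k ^+ 2).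
have c_ge0 : 0 <= c by rewrite mulr_ge0 // addr_ge0 // sqr_ge0.
have px_ge0 := cseminorm_ge0 x.
suff le_y t : 0 < t -> p x <= p y + t * (s * c * p x).
  have e_ge0 : 0 <= s * c * p x by rewrite mulr_ge0 // mulr_ge0.
  apply/ler_addgt0Pr => e e_gt0.
  have d_gt0 : 0 < 1 + s * c * p x by rewrite ltr_pwDl.
  apply: (le_trans (le_y (e / (1 + s * c * p x)) _)); first by rewrite divr_gt0.
  by rewrite lerD2l mulrAC ler_pdivrMr // ler_pM2l // lerDr ler01.
move=> t_gt0; have t_ge0 := ltW t_gt0.
pose v := x - t%:C *: ((h + k) ** x).
have le_v : p v <= (1 + t ^+ 2 * c) * p x.
  have t2_ge0 : 0 <= 2 * t by rewrite mulr_ge0.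
  have le_h := accretive_sub_le x acc_h t2_ge0.
  have le_k := accretive_sub_le x acc_k t2_ge0.
  have eq_v : (2 : R)%:C *: v = (x - (2 * t)%:C *: (h ** x)) +
                                (x - (2 * t)%:C *: (k ** x)).
    by rewrite /v !star_expand; lmodule_eq R[i] A; ring.
  have := cseminormD (x - (2 * t)%:C *: (h ** x)) (x - (2 * t)%:C *: (k ** x)).
  rewrite -eq_v cseminormZr ger0_norm // => le2.
  have {}le2 := le_trans le2 (lerD le_h le_k).
  rewrite -(ler_pM2l (ltr0n R 2)) (le_trans le2) // /c; nra.
have eq_x : (t + s)%:C *: x = t%:C *: y + s%:C *: v.
  by rewrite /y /v !star_expand; lmodule_eq R[i] A; ring.
have := cseminormD (t%:C *: y) (s%:C *: v).
rewrite -eq_x !cseminormZr !ger0_norm ?addr_ge0 // => le_x.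
rewrite -(ler_pM2l t_gt0).
have := ler_wpM2l s_ge0 le_v; nra.
Qed.

(* With T := tau q and tau := 2 / (5 p q), the identity
   16 T = \sum_(j < 4) i^-j (1 + i^j T)^4 bounds 6.4 = 16 tau (p q) by the norms
   of the four powers; accretivity makes these so small that the bound fails
   unless p (q + h) is comparable with p q. *)
Lemma cseminorm_le_accretive q h : star q = q -> accretive q -> accretive h ->
  p q <= 40 * p (q + h).
Proof.
move=> sa_q acc_q acc_h; rewrite leNgt; apply/negP => lt_q.
set N := p q in lt_q; set B := p (q + h) in lt_q.
have B_ge0 : 0 <= B by apply: cseminorm_ge0.
have N_gt0 : 0 < N by apply: le_lt_trans lt_q; rewrite mulr_ge0.
pose t : R := 2 / (5 * N).
have tN : t * N = 2 / 5 by rewrite /t; field; rewrite gt_eqF.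
have t_gt0 : 0 < t by rewrite divr_gt0 // mulr_gt0.
have t_ge0 := ltW t_gt0.
have tB : t * B <= 1 / 100.
  have := ler_wpM2l t_ge0 (ltW lt_q); rewrite tN; lra.
have tN2 : t ^+ 2 * N ^+ 2 = 4 / 25 by rewrite -exprMn tN; field.
have le_qq y : p (q ** (q ** y)) <= N ^+ 2 * p y.
  apply: (le_trans (cseminormM _ _)); rewrite expr2 -mulrA.
  by rewrite ler_wpM2l ?cseminorm_ge0 // cseminormM.
pose f z y := y + z *: (q ** y).
(* (1 + t h) (1 + t q) = 1 - t^2 q^2 + t (q + h) (1 + t q), where the last term contributes at most
   [t * B <= 1 / 100] times the seminorm of [f t%:C y]. The factor is (29 / 25) / (1 - 1 / 100),
   with 29 / 25 = 1 + (t N)^2. *)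
have f_real y : p (f t%:C y) <= 116 / 99 * p y.
  have := acc_h t (f t%:C y) t_ge0.
  have -> : f t%:C y + t%:C *: (h ** f t%:C y) =
      (y - (t ^+ 2)%:C *: (q ** (q ** y))) + t%:C *: ((q + h) ** f t%:C y).
    by rewrite /f !star_expand; lmodule_eq R[i] A; ring.
  move=> /le_trans/(_ (cseminormD _ _)).
  have le1 := cseminormB y ((t ^+ 2)%:C *: (q ** (q ** y))).
  have le2 := cseminormM (q + h) (f t%:C y).
  have le3 := ler_wpM2r (cseminorm_ge0 (f t%:C y)) tB.
  have le4 := ler_wpM2l (sqr_ge0 t) (le_qq y).
  have le5 := ler_wpM2l t_ge0 le2.
  rewrite mulrA tN2 in le4.
  rewrite !cseminormZr (ger0_norm t_ge0) (ger0_norm (sqr_ge0 t)) in le1 *.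
  rewrite -/B in le5; lra.
have f_opp y : p (f (- t%:C) y) <= 29 / 25 * p y.
  have := accretive_sub_le y acc_q t_ge0; rewrite -/N tN2 /f scaleNr; lra.
(* The terms linear in q cancel in f' f because q is self-adjoint; [e] selects the sign of i. *)
have f_imag (e : bool) y :
    p (f ((-1) ^+ e * ('i%C * t%:C)) y) ^+ 2 <= 29 / 25 * p y ^+ 2.
  rewrite -!cseminorm_star_mul.
  have -> : star (f ((-1) ^+ e * ('i%C * t%:C)) y) **
            f ((-1) ^+ e * ('i%C * t%:C)) y =
      star y ** y + (t ^+ 2)%:C *: (star y ** (q ** (q ** y))).
    rewrite /f; case: e; rewrite ?expr1 ?expr0 ?mulN1r ?mul1r ?scaleNr -!scalerA;
    rewrite !star_expand sa_q; lmodule_eq R[i] A; ring: (@mulCi R).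
  apply: (le_trans (cseminormD _ _)).
  rewrite cseminorm_star_mul cseminormZr (ger0_norm (sqr_ge0 t)).
  have le1 := cseminormM (star y) (q ** (q ** y)).
  have le2 := ler_wpM2l (cseminorm_ge0 y) (le_qq y).
  rewrite cseminorm_star in le1.
  have := ler_wpM2l (sqr_ge0 t) (le_trans le1 le2).
  have -> : t ^+ 2 * (p y * (N ^+ 2 * p y)) = 4 / 25 * p y ^+ 2.
    by rewrite -tN2; ring.
  lra.
have f_imag4 (e : bool) :
    p (iter 4 (f ((-1) ^+ e * ('i%C * t%:C))) q) <= (29 / 25) ^+ 2 * N.
  set g := f _.
  have g_le y : p (g y) ^+ 2 <= 29 / 25 * p y ^+ 2 by exact: (f_imag e).
  rewrite -(@ler_pXn2r _ 2) ?nnegrE ?cseminorm_ge0 //; last first.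
    by rewrite mulr_ge0 ?sqr_ge0 // ltW.
  rewrite /N /=.
  have := g_le q; have := g_le (g q); have := g_le (g (g q)).
  have := g_le (g (g (g q))); lra.
have f_real4 : p (iter 4 (f t%:C) q) <= (116 / 99) ^+ 4 * N.
  rewrite /N /=; have := f_real q; have := f_real (f t%:C q).
  have := f_real (f t%:C (f t%:C q)).
  have := f_real (f t%:C (f t%:C (f t%:C q))); lra.
have f_opp4 : p (iter 4 (f (- t%:C)) q) <= (29 / 25) ^+ 4 * N.
  rewrite /N /=; have := f_opp q; have := f_opp (f (- t%:C) q).
  have := f_opp (f (- t%:C) (f (- t%:C) q)).
  have := f_opp (f (- t%:C) (f (- t%:C) (f (- t%:C) q))); lra.
have eq_q : (16 * t)%:C *: (q ** q) =
    (iter 4 (f t%:C) q - iter 4 (f (- t%:C)) q) -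
    'i%C *: (iter 4 (f ((-1) ^+ false * ('i%C * t%:C))) q -
             iter 4 (f ((-1) ^+ true * ('i%C * t%:C))) q).
  rewrite /= /f expr0 expr1 !star_expand; lmodule_eq R[i] A; ring: (@mulCi R).
have : p ((16 * t)%:C *: (q ** q)) = 32 / 5 * N.
  have t16_ge0 : 0 <= 16 * t by rewrite mulr_ge0.
  have -> : q ** q = star q ** q by rewrite sa_q.
  rewrite cseminormZr (ger0_norm t16_ge0) cseminorm_star_mul -/N.
  have -> : 16 * t * N ^+ 2 = 16 * (t * N) * N by ring.
  by rewrite tN; field.
have := f_imag4 false; have := f_imag4 true; rewrite eq_q.
set u1 := iter _ _ _; set u2 := iter _ _ _.
have := cseminormB (iter 4 (f t%:C) q - iter 4 (f (- t%:C)) q)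
  ('i%C *: (u2 - u1)).
have := cseminormB (iter 4 (f t%:C) q) (iter 4 (f (- t%:C)) q).
have := cseminormB u2 u1.
(* The four bounds add up to about 6.387 N, less than 32 / 5 N. *)
rewrite cseminormZi; lra.
Qed.

(* Write a' for the adjoint of a and put c := a' a + b' b and e := b a'.  The
   identity e' e + e e' + (a a')^2 + (b b')^2 = a c a' + b c b' has only sums of
   squares of self-adjoint elements on its left-hand side, since e' e + e e' is
   one, so its right-hand side dominates (a a')^2. *)
Lemma cseminorm_le_sum a b :
  p (star a ** a) <= 81 * p (star a ** a + star b ** b).
Proof.
set c := star a ** a + star b ** b.
pose e := b ** star a.
pose e1 := e + star e; pose e2 := 'i%C *: (e - star e).
pose u := a ** star a; pose v := b ** star b.
have sa_u : star u = u by rewrite /u starM starK.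
have sa_v : star v = v by rewrite /v starM starK.
have sa_e1 : star e1 = e1 by rewrite /e1 starD starK addrC.
have sa_e2 : star e2 = e2.
  by rewrite /e2 !star_expand; lmodule_eq R[i] A; ring.
(* Everything is doubled because e1^2 + e2^2 = 2 (e' e + e e'). *)
pose q := u ** u + u ** u.
pose h := (v ** v + v ** v) + (e1 ** e1 + e2 ** e2).
have sa_q : star q = q by rewrite /q !star_expand.
have acc_q : accretive q by apply: accretiveD; apply: accretive_sqr.
have acc_h : accretive h by do !apply: accretiveD; apply: accretive_sqr.
have := cseminorm_le_accretive sa_q acc_q acc_h.
have -> : q + h = 2%:C *: (a ** c ** star a + b ** c ** star b).
  rewrite /q /h /u /v /e1 /e2 /e /c !star_expand.
  lmodule_eq R[i] A; ring: (@mulCi R).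
have -> : q = 2%:C *: (u ** u) by rewrite /q; lmodule_eq R[i] A; ring.
have p_c x : p (x ** c ** star x) <= p x ^+ 2 * p c.
  apply: (le_trans (cseminormM _ _)); rewrite cseminorm_star mulrC expr2 -mulrA.
  by rewrite ler_wpM2l ?cseminorm_ge0 // cseminormM.
have p_b : p b ^+ 2 <= p c + p a ^+ 2.
  rewrite -!cseminorm_star_mul -[star b ** b](addKr (star a ** a)) -/c addrC.
  exact: cseminormB.
rewrite !cseminormZr ger0_norm // cseminorm_star_mul.
rewrite -{1}sa_u cseminorm_star_mul /u cseminorm_mul_star.
have := cseminormD (a ** c ** star a) (b ** c ** star b).
have := p_c a; have := p_c b.
have := ler_wpM2r (cseminorm_ge0 c) p_b.
have := cseminorm_ge0 c; have := sqr_ge0 (p a).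
move: (p c) (p a ^+ 2) (p b ^+ 2) (p (a ** c ** _)) (p (b ** c ** _))
  (p (_ + _)).
move=> C X Y X' Y' S X_ge0 C_ge0 le1 le2 le3 le4 le5.
(* With X = [p a ^+ 2] and C = [p c], the bounds combine to X^2 <= 40 (X C + (C + X) C), which
   excludes X > 81 C. *)
rewrite leNgt; apply/negP => lt_X.
have X_gt0 : 0 < X by lra.
have le_X : X * X <= 80 * (X * C) + 40 * (C * C) by lra.
have := ler_wpM2l C_ge0 (ltW lt_X); have := lt_X; rewrite -(ltr_pM2l X_gt0).
have := mulr_ge0 C_ge0 C_ge0; lra.
Qed.

End CstarSeminorm.

(** * Seminorms of pre-Hilbert modules *)

Section Modules.
Variables (R : realType) (A : locCstarAlgType R) (E : preHilbertModType A).
Implicit Types (x y z : E) (a b : A) (r t : R).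

Lemma innerDl x x' y : inner (x + x') y = inner x y + inner x' y.
Proof. by rewrite -star_inner innerDr starD !star_inner. Qed.

Lemma innerZl (c : R[i]) x y : inner (c *: x) y = c^*%C *: inner x y.
Proof. by rewrite -star_inner innerZr starZ star_inner. Qed.

Lemma innerNl x y : inner (- x) y = - inner x y.
Proof. by rewrite -scaleN1r innerZl rmorphN1 scaleN1r. Qed.

Lemma innerNr x y : inner x (- y) = - inner x y.
Proof. by rewrite -scaleN1r innerZr scaleN1r. Qed.

Lemma inner_ractl x y a : inner (ract x a) y = star a ** inner x y.
Proof. by rewrite -star_inner inner_ract starM star_inner. Qed.

Lemma innerZrl r x y : inner (r%:C *: x) y = r%:C *: inner x y.
Proof. by rewrite innerZl conjc_real. Qed.

Definition inner_expand := (innerDl, @innerDr R A E, innerNl, innerNr, innerZrl,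
  @innerZr R A E, inner_ractl, @inner_ract R A E).

Lemma eq_inner x y : (forall z, inner x z = inner y z) -> x = y.
Proof.
move=> eq_xy; apply/eqP; rewrite -subr_eq0; apply/eqP/inner_eq0.
by rewrite innerDl innerNl eq_xy subrr.
Qed.

Section Seminorm.
Variable p : A -> R.
Hypothesis hp : cstar_seminorm p.

Lemma hbar_ge0 x : 0 <= hbar p x. Proof. exact: sqrtr_ge0. Qed.

Lemma sqr_hbar x : hbar p x ^+ 2 = p (inner x x).
Proof. by rewrite sqr_sqrtr // (cseminorm_ge0 hp). Qed.

Lemma hbarN x : hbar p (- x) = hbar p x.
Proof. by rewrite /hbar innerNl innerNr opprK. Qed.

Lemma hbarBC x y : hbar p (x - y) = hbar p (y - x).
Proof. by rewrite -hbarN opprB. Qed.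

(** By the parallelogram law, <x+y,x+y> and the positive element <x-y,x-y> add up to 2 (<x,x> +
    <y,y>), so [cseminorm_le_sum] applies. The constant comes from 2 * 81 <= 13^2. *)
Lemma hbarD x y : hbar p (x + y) <= 13 * (hbar p x + hbar p y).
Proof.
have [b eq_b] := inner_pos (x + y); have [c eq_c] := inner_pos (x - y).
have := cseminorm_le_sum hp b c; rewrite -eq_b -eq_c.
have -> : inner (x + y) (x + y) + inner (x - y) (x - y) =
    2%:C *: (inner x x + inner y y).
  by rewrite !inner_expand; lmodule_eq R[i] A; ring.
rewrite (cseminormZr hp) ger0_norm // -!sqr_hbar => le_xy.
have := cseminormD hp (inner x x) (inner y y); rewrite -!sqr_hbar.
have := hbar_ge0 x; have := hbar_ge0 y => y_ge0 x_ge0 le_sum.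
rewrite -(@ler_pXn2r _ 2) ?nnegrE ?hbar_ge0 ?mulr_ge0 ?addr_ge0 //.
have := mulr_ge0 x_ge0 y_ge0; nra.
Qed.

Lemma hbar_triangle y x z :
  hbar p (x - z) <= 13 * (hbar p (x - y) + hbar p (y - z)).
Proof. by rewrite -(subrKA y) hbarD. Qed.

(** For z = x u - t y one has 2 t u' u + <z,z> = u' <x,x> u + t^2 <y,y>; [cseminorm_le_sum] discards
    <z,z> at the cost of a factor 81. *)
Lemma hbar_cauchy_schwarz x y : p (inner x y) <= 81 * (hbar p x * hbar p y).
Proof.
set u := inner x y.
have le_u t : 0 <= t -> 2 * t * p u ^+ 2 <=
    81 * (hbar p x ^+ 2 * p u ^+ 2 + t ^+ 2 * hbar p y ^+ 2).
  move=> t_ge0; pose z := ract x u - t%:C *: y.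
  have t2_ge0 : 0 <= 2 * t by rewrite mulr_ge0.
  pose a := (Num.sqrt (2 * t))%:C *: u; have [b eq_b] := inner_pos z.
  have eq_a : star a ** a = (2 * t)%:C *: (star u ** u).
    rewrite -[in RHS](sqr_sqrtr t2_ge0) /a !star_expand.
    by lmodule_eq R[i] A; ring.
  have := cseminorm_le_sum hp a b; rewrite -eq_b eq_a.
  have -> : (2 * t)%:C *: (star u ** u) + inner z z =
      star u ** inner x x ** u + (t ^+ 2)%:C *: inner y y.
    rewrite /z !inner_expand -(star_inner x y) -/u !star_expand.
    by lmodule_eq R[i] A; ring.
  rewrite (cseminormZr hp) ger0_norm // (cseminorm_star_mul hp).
  move=> /le_trans; apply; rewrite ler_pM2l //.
  apply: (le_trans (cseminormD hp _ _)).
  rewrite (cseminormZr hp) ger0_norm ?sqr_ge0 // -!sqr_hbar lerD2r.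
  apply: (le_trans (cseminormM hp _ _)); rewrite [p u ^+ 2]expr2 mulrA.
  rewrite ler_wpM2r ?(cseminorm_ge0 hp) //.
  apply: (le_trans (cseminormM hp _ _)).
  by rewrite (cseminorm_star hp) mulrC sqr_hbar.
have := hbar_ge0 x; have := hbar_ge0 y; have := cseminorm_ge0 hp u.
move: (hbar p x) (hbar p y) (p u) le_u => X Y U le_u U_ge0 Y_ge0 X_ge0.
move: X_ge0; rewrite le_eqVlt => /predU1P[X0|X_gt0].
  rewrite -X0 mul0r mulr0 leNgt; apply/negP => U_gt0.
  (* For X = 0, [le_u] reads 2 U^2 <= 81 t Y^2 when t > 0, which fails for t = U^2 / d; the [+ 1]
     covers Y = 0. *)
  pose d := 81 * (Y ^+ 2 + 1).
  have d_gt0 : 0 < d by rewrite mulr_gt0 // ltr_wpDl // sqr_ge0.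
  have t_gt0 : 0 < U ^+ 2 / d by rewrite divr_gt0 // exprn_gt0.
  have := le_u _ (ltW t_gt0); rewrite -X0 expr0n mul0r add0r.
  set t := U ^+ 2 / d in t_gt0 *.
  have -> : U ^+ 2 = t * d by rewrite /t mulfVK // gt_eqF.
  rewrite /d.
  have := mulr_gt0 t_gt0 t_gt0; have := sqr_ge0 Y.
  have := mulr_ge0 (mulr_ge0 (ltW t_gt0) (ltW t_gt0)) (sqr_ge0 Y); lra.
have X_ge0 := ltW X_gt0.
rewrite -(@ler_pXn2r _ 2) ?nnegrE ?mulr_ge0 //.
have X2_gt0 : 0 < X ^+ 2 by rewrite exprn_gt0.
rewrite -(ler_pM2l X2_gt0).
(* For t = 81 X^2 the term 81 X^2 U^2 is half of the left-hand side. *)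
have /le_u : 0 <= 81 * X ^+ 2 by rewrite mulr_ge0 // ltW.
lra.
Qed.

End Seminorm.
End Modules.

(** The filter concentrated at [a] converges both to [a] and, since every seminorm vanishes there,
    to 0. *)
Lemma cont_seminorms_eq0 (R : realType) (A : locCstarAlgType R) (a : A) :
  (forall p, cont_seminorms p -> p a = 0) -> a = 0.
Proof.
move=> p_a; apply/esym/hausdorff_locCstar => U V U0 Va.
have a_to_0 : globally [set a] --> (0 : A).
  have proper_a : ProperFilter (globally [set a]).
    by apply: (@globally_properfilter _ _ a).
  apply/(@cvg0_locCstar _ _ (globally [set a])) => p /p_a p_a0 W W0 b /= ->.
  by rewrite p_a0; apply: nbhs_singleton.
by exists a; split; [apply: (a_to_0 U U0) | apply: nbhs_singleton].
Qed.

(** * Density of the bounded elements *)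

Section Resolvent.
Variables (R : realType) (A : starAlgType R).
Implicit Types (a w r : A).

(* Pairs (w, r) with w + a w = a + r and r tending to 0, so that w tends to
   a (1 + a)^-1.  The iteration r <- (1 - s (1 + a)) r with s = 1 / (n + 2)
   converges in all C*-seminorms at once although they have no common bound. *)
Fixpoint resolvent_iter a n : A * A :=
  if n is m.+1 then
    let: (w, r) := resolvent_iter a m in
    let s := (m.+2%:R^-1 : R)%:C in (w - s *: r, r - s *: (r + a ** r))
  else (0, - a).

Lemma resolvent_iterE a n :
  (resolvent_iter a n).1 + a ** (resolvent_iter a n).1 =
  a + (resolvent_iter a n).2.
Proof.
elim: n => [|n] /=.
  by rewrite -(scale0r (0 : A)) amulZr !scale0r addr0 subrr.
case: (resolvent_iter a n) => w r /= eq_w.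
set s := _%:C; rewrite addrA -eq_w !star_expand; lmodule_eq R[i] A; ring.
Qed.

Variable p : A -> R.
Hypothesis hp : cstar_seminorm p.

(** The new error is (1 - s) r - s a r; for skew [a] the cross terms in its C*-square cancel. *)
Lemma cseminorm_skew_step a r (s : R) : star a = - a ->
  p (r - s%:C *: (r + a ** r)) ^+ 2 <=
  ((1 - s) ^+ 2 + s ^+ 2 * p a ^+ 2) * p r ^+ 2.
Proof.
move=> skew_a; rewrite -(cseminorm_star_mul hp).
have -> : star (r - s%:C *: (r + a ** r)) ** (r - s%:C *: (r + a ** r)) =
    ((1 - s) ^+ 2)%:C *: (star r ** r) +
    (s ^+ 2)%:C *: (star (a ** r) ** (a ** r)).
  by rewrite !star_expand skew_a !star_expand; lmodule_eq R[i] A; ring.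
apply: (le_trans (cseminormD hp _ _)).
rewrite !(cseminormZr hp) !ger0_norm ?sqr_ge0 // !(cseminorm_star_mul hp).
rewrite mulrDl lerD2l -[_ * p a ^+ 2 * _]mulrA -[p a ^+ 2 * _]exprMn.
rewrite ler_wpM2l ?sqr_ge0 //.
by rewrite ler_pXn2r ?nnegrE ?mulr_ge0 ?(cseminorm_ge0 hp) // (cseminormM hp).
Qed.

(** Once s (1 + p(a)^2) <= 1, the factor of [cseminorm_skew_step] is at most 1 - s = (n + 1) / (n +
    2). Hence (n + 1) p(r_n)^2 is nonincreasing from some N on, which may depend on p, and p(r_n) =
    O(n^(-1/2)). *)
Lemma resolvent_iter_cvg a (e : R) : star a = - a -> 0 < e ->
  \forall n \near \oo, p (resolvent_iter a n).2 < e.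
Proof.
move=> skew_a e_gt0; pose r n := (resolvent_iter a n).2.
have d_gt0 : 0 < 1 + p a ^+ 2 by rewrite ltr_pwDl // sqr_ge0.
have [N _ N_small] : \forall n \near \oo, (n.+1%:R^-1 : R) < (1 + p a ^+ 2)^-1.
  have di_gt0 : 0 < (1 + p a ^+ 2)^-1 by rewrite invr_gt0.
  exact: (near_infty_natSinv_lt (PosNum di_gt0)).
have step n : (N <= n)%N ->
    n.+2%:R * p (r n.+1) ^+ 2 <= n.+1%:R * p (r n) ^+ 2.
  move=> le_Nn; pose s : R := n.+2%:R^-1.
  have n_gt0 : 0 < n.+2%:R :> R by rewrite ltr0n.
  have s_gt0 : 0 < s by rewrite invr_gt0.
  have s_le : s * (1 + p a ^+ 2) <= 1.
    rewrite -ler_pdivlMr // mul1r ltW //.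
    by apply: N_small; rewrite /= (leq_trans le_Nn).
  have -> : n.+1%:R = n.+2%:R * (1 - s) :> R.
    by rewrite mulrBr mulr1 mulfV ?gt_eqF // -(natr1 n.+1) addrK.
  rewrite -mulrA ler_pM2l //.
  have -> : r n.+1 = r n - s%:C *: (r n + a ** r n).
    by rewrite /r /=; case: (resolvent_iter a n).
  apply: (le_trans (cseminorm_skew_step _ _ skew_a)).
  rewrite ler_wpM2r ?sqr_ge0 //.
  have := ler_wpM2l (ltW s_gt0) s_le; rewrite mulr1; lra.
pose C := N.+1%:R * p (r N) ^+ 2.
have C_ge0 : 0 <= C by rewrite mulr_ge0 ?sqr_ge0.
have le_C n : (N <= n)%N -> n.+1%:R * p (r n) ^+ 2 <= C.
  elim: n => [|n IHn]; first by rewrite leqn0 => /eqP N0; rewrite /C N0.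
  rewrite leq_eqVlt => /predU1P[<- //|]; rewrite ltnS => le_Nn.
  exact: le_trans (step n le_Nn) (IHn le_Nn).
have C1_gt0 : 0 < C + 1 by rewrite ltr_wpDl.
have e2_gt0 : 0 < e ^+ 2 / (C + 1) by rewrite divr_gt0 // exprn_gt0.
near=> n.
have n_gt0 : 0 < n.+1%:R :> R by rewrite ltr0n.
have le_Nn : (N <= n)%N by near: n; exact: nbhs_infty_ge.
have : (n.+1%:R^-1 : R) < e ^+ 2 / (C + 1).
  by near: n; exact: (near_infty_natSinv_lt (PosNum e2_gt0)).
rewrite ltr_pdivlMr // mulrC ltr_pdivrMr // => lt_C.
rewrite -(@ltr_pXn2r _ 2) ?nnegrE ?(cseminorm_ge0 hp) ?ltW //.
rewrite -(ltr_pM2l n_gt0) (le_lt_trans (le_C n le_Nn)) //.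
by rewrite mulrC (lt_trans _ lt_C) // ltrDl.
Unshelve. all: by end_near. Qed.

Section Bounds.
Variables (a w r : A).
Hypothesis skew_a : star a = - a.
Hypothesis eq_w : w + a ** w = a + r.

Lemma resolvent_le : p w <= p a + p r.
Proof.
apply: (le_trans (cseminorm_le_skew hp w skew_a)).
by rewrite eq_w (cseminormD hp).
Qed.

(* Up to the error r, the element v := 1 - w is the inverse of 1 + a, whose
   adjoint is 1 - a; so v + v' = 2 v' v, that is, w + w' = 2 w' w. *)
Lemma resolvent_le3 : p r <= 1 -> p w <= 3.
Proof.
move=> r_le1.
have aw : a ** w = a + r - w by rewrite -eq_w addrC addKr.
have wa : star w ** a = a - star r + star w.
  have := congr1 star aw; rewrite !star_expand skew_a amulNr.
  by move/(congr1 -%R); rewrite opprK => ->; lmodule_eq R[i] A; ring.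
(* Both products equal w' a w. *)
have eq0 : (a - star r + star w) ** w - star w ** (a + r - w) = 0.
  by rewrite -aw -wa amulA subrr.
have eq_ww : 2%:C *: (star w ** w) =
    (w + star w) - (r + star r) + (star w ** r + star r ** w).
  apply/eqP; rewrite -subr_eq0; apply/eqP.
  rewrite -eq0 !star_expand aw wa.
  by lmodule_eq R[i] A; ring.
have : p (2%:C *: (star w ** w)) <=
    (p w + p w) + (p r + p r) + (p w * p r + p r * p w).
  rewrite eq_ww; apply: (le_trans (cseminormD hp _ _)); apply: lerD.
    apply: (le_trans (cseminormB hp _ _)); apply: lerD;
    by apply: (le_trans (cseminormD hp _ _)); rewrite (cseminorm_star hp).
  apply: (le_trans (cseminormD hp _ _)); apply: lerD;
  by apply: (le_trans (cseminormM hp _ _)); rewrite (cseminorm_star hp).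
rewrite (cseminormZr hp) ger0_norm // (cseminorm_star_mul hp).
have := cseminorm_ge0 hp w; have := cseminorm_ge0 hp r.
move: (p w) (p r) r_le1 => W r' r'_le1 r'_ge0 W_ge0 le_W.
(* Now W^2 <= 2 W + 1, so W <= 1 + sqrt(2) < 3. *)
have le_Wr' := ler_wpM2l W_ge0 r'_le1.
rewrite leNgt; apply/negP => W_gt3; have W_gt0 : 0 < W by lra.
by have := W_gt3; rewrite -(ltr_pM2l W_gt0); lra.
Qed.

End Bounds.
End Resolvent.

Section Density.
Variables (R : realType) (A : locCstarAlgType R) (E : hilbertModType A).
Implicit Types (x y : E) (s : nat -> E).

Definition hbar_cvg s x := forall (p : A -> R) (e : R),
  cont_seminorms p -> 0 < e -> \forall n \near \oo, hbar p (s n - x) < e.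

(** In both uses the distance of two terms is bounded by the sum of their errors; the indices with
    error below e / 2 then give a set of diameter below e. *)
Lemma hilbert_seq_complete s :
  (forall p : A -> R, cont_seminorms p -> exists2 u : nat -> R,
    (forall e : R, 0 < e -> \forall n \near \oo, u n < e) &
    forall m n, hbar p (s m - s n) <= u m + u n) ->
  exists x, hbar_cvg s x.
Proof.
move=> cauchy_s.
have [p e cont_p e_gt0|x x_lim] := @hilbert_complete _ _ E (s @ \oo) _.
  have [u u_lim s_le] := cauchy_s p cont_p.
  have e2_gt0 : 0 < e / 2 by rewrite divr_gt0.
  exists (s @` [set n | u n < e / 2]).
    by apply: filterS (u_lim _ e2_gt0) => n un_lt; exists n.
  move=> _ _ [m /= um_lt <-] [n /= un_lt <-].
  by apply: (le_lt_trans (s_le m n)); rewrite (splitr e) ltrD.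
exists x => p e cont_p e_gt0.
have /cvgrPdist_lt/(_ e e_gt0) := x_lim p cont_p.
have near_lt : forall y, `|0 - hbar p (y - x)| < e -> hbar p (y - x) < e.
  by move=> y; rewrite sub0r normrN ger0_norm ?hbar_ge0.
by move=> near_s; near=> n; apply: near_lt; near: n; exact: near_s.
Unshelve. all: by end_near. Qed.

Lemma hbar_ract_le (p : A -> R) x a : cstar_seminorm p ->
  hbar p (ract x a) <= hbar p x * p a.
Proof.
move=> hp.
rewrite -(@ler_pXn2r _ 2) ?nnegrE ?mulr_ge0 ?hbar_ge0 ?(cseminorm_ge0 hp) //.
rewrite exprMn !(sqr_hbar hp) inner_ractl inner_ract.
apply: (le_trans (cseminormM hp _ _)).
rewrite (cseminorm_star hp) mulrC [p a ^+ 2]expr2 mulrA.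
by rewrite ler_wpM2r ?(cseminorm_ge0 hp) // (cseminormM hp).
Qed.

Lemma mod_bounded_eltsP x (K : R) :
  (forall p : A -> R, cont_seminorms p -> hbar p x <= K) -> mod_bounded_elts E x.
Proof.
move=> x_le; apply: (@le_lt_trans _ _ K%:E); last exact: ltry.
by apply: ub_ereal_sup => _ [p /x_le px_le <-]; rewrite lee_fin.
Qed.

(* With h := <x,x> = c k and v := (1 + i k)^-1, the element y := x v has
   <y,y> = c v' k v, of norm at most c, and x - y = x (i k) v is small. *)
Lemma mod_bounded_approx x (c : R) : 0 < c -> exists2 y, mod_bounded_elts E y &
  forall p : A -> R, cont_seminorms p ->
    hbar p (x - y) <= 13 * (hbar p x * (hbar p x ^+ 2 + 1) + 1) / c.
Proof.
move=> c_gt0; have c_neq0 : c != 0 by rewrite gt_eqF.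
have ci_gt0 : 0 < c^-1 by rewrite invr_gt0.
pose k := (c^-1)%:C *: inner x x.
have eq_h : inner x x = c%:C *: k.
  by rewrite /k scalerA -rmorphM /= mulfV // scale1r.
have sa_k : star k = k by rewrite /k starZr star_inner.
pose a := 'i%C *: k.
have skew_a : star a = - a by rewrite /a starZi sa_k.
pose w n := (resolvent_iter a n).1; pose r n := (resolvent_iter a n).2.
have eq_w n : w n + a ** w n = a + r n by apply: resolvent_iterE.
(* Since w n tends to a (1 + a)^-1, [s n] approximates x v with v = (1 + a)^-1. *)
pose s n := x - ract x (w n).
have r_lim p e : cont_seminorms p -> 0 < e -> \forall n \near \oo, p (r n) < e.
  by move=> [hp _]; exact: resolvent_iter_cvg.
have [|y y_lim] := @hilbert_seq_complete s.
  move=> p cont_p; have hp := cont_p.1.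
  (* (1 + a) (w n - w m) = r n - r m, and [cseminorm_le_skew] removes the factor 1 + a. *)
  exists (fun n => hbar p x * p (r n)).
    move=> e e_gt0.
    have d_gt0 : 0 < hbar p x + 1 by rewrite ltr_wpDl ?hbar_ge0.
    have ed_gt0 : 0 < e / (hbar p x + 1) by rewrite divr_gt0.
    near=> n; have : p (r n) < e / (hbar p x + 1) by near: n; exact: r_lim.
    rewrite ltr_pdivlMr //; apply: le_lt_trans.
    by rewrite mulrDr mulr1 mulrC lerDl (cseminorm_ge0 hp).
  move=> m n; have -> : s m - s n = ract x (w n - w m).
    rewrite /s ractDr -[- w m]scaleN1r ractZr; lmodule_eq R[i] E; ring.
  apply: (le_trans (hbar_ract_le _ _ hp)).
  rewrite -mulrDr ler_wpM2l ?hbar_ge0 //.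
  apply: (le_trans (cseminorm_le_skew hp _ skew_a)).
  have -> : w n - w m + a ** (w n - w m) = r n - r m.
    have -> : w n - w m + a ** (w n - w m) =
        (w n + a ** w n) - (w m + a ** w m).
      by rewrite !star_expand; lmodule_eq R[i] A; ring.
    by rewrite !eq_w; lmodule_eq R[i] A; ring.
  by rewrite [leRHS]addrC; exact: (cseminormB hp).
exists y.
  (* [K] may not depend on p, but n below may. The 16 is (1 + 3) (3 + 1), a bound for the seminorm
     of (1 - w') (w - r). *)
  pose K := 13 * (1 + (16 * c + 1)).
  apply: (@mod_bounded_eltsP y K) => p cont_p; have hp := cont_p.1.
  near \oo => n.
  have r_lt : p (r n) < 1 by near: n; exact: r_lim.
  have s_lt : hbar p (s n - y) < 1 by near: n; exact: y_lim.
  have w_le : p (w n) <= 3.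
    by apply: (resolvent_le3 hp skew_a (eq_w n)); exact: ltW.
  (* The left-hand side is c (1 - w') a (1 - w), and a (1 - w) = w - r. *)
  have eq_s : 'i%C *: inner (s n) (s n) =
      c%:C *: (w n - r n - star (w n) ** (w n - r n)).
    have -> : w n - r n = a - a ** w n.
      have -> : w n - r n = w n + a ** w n - a ** w n - r n.
        by lmodule_eq R[i] A; ring.
      by rewrite eq_w; lmodule_eq R[i] A; ring.
    rewrite /s !inner_expand eq_h /a !star_expand.
    by lmodule_eq R[i] A; ring.
  have s_le : hbar p (s n) ^+ 2 <= 16 * c.
    rewrite sqr_hbar // -(cseminormZi hp) eq_s (cseminormZr hp) gtr0_norm //.
    rewrite mulrC ler_pM2r //.
    have wr_le := cseminormB hp (w n) (r n).
    have := cseminormB hp (w n - r n) (star (w n) ** (w n - r n)).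
    have := cseminormM hp (star (w n)) (w n - r n).
    have := ler_wpM2r (cseminorm_ge0 hp (w n - r n)) w_le.
    rewrite (cseminorm_star hp); lra.
  have s_le2 : hbar p (s n) <= 16 * c + 1.
    have := sqr_ge0 (hbar p (s n) - 1); have := hbar_ge0 p (s n); nra.
  have := hbarD hp (y - s n) (s n); rewrite subrK hbarBC // => le_y.
  apply: (le_trans le_y); rewrite /K ler_pM2l // lerD // ltW //.
move=> p cont_p; have hp := cont_p.1.
near \oo => n.
have r_lt : p (r n) < c^-1 by near: n; exact: r_lim.
have s_lt : hbar p (s n - y) < c^-1 by near: n; exact: y_lim.
have w_le : p (w n) <= (hbar p x ^+ 2 + 1) / c.
  apply: (le_trans (resolvent_le hp skew_a (eq_w n))).
  rewrite /a (cseminormZi hp) /k (cseminormZr hp) gtr0_norm // -sqr_hbar //.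
  by rewrite mulrDl mul1r mulrC lerD2l ltW.
apply: (le_trans (hbar_triangle hp (s n) _ _)); rewrite -mulrA ler_pM2l //.
rewrite mulrDl mul1r; apply: lerD; last exact: ltW.
have -> : x - s n = ract x (w n) by rewrite /s opprB addrC subrK.
apply: (le_trans (hbar_ract_le _ _ hp)).
by rewrite -mulrA ler_wpM2l ?hbar_ge0.
Unshelve. all: by end_near. Qed.

(** Taking c = n + 1 serves all seminorms at once, so a sequence suffices even if the topology is
    not metrizable. *)
Lemma mod_bounded_dense x :
  exists2 s, forall n, mod_bounded_elts E (s n) & hbar_cvg s x.
Proof.
have /choice[s s_approx] : forall n : nat, exists y, mod_bounded_elts E y /\
    forall p : A -> R, cont_seminorms p -> hbar p (x - y) <=
      13 * (hbar p x * (hbar p x ^+ 2 + 1) + 1) / n.+1%:R.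
  move=> n; have n_gt0 : 0 < n.+1%:R :> R by rewrite ltr0n.
  by have [y] := mod_bounded_approx x n_gt0; exists y.
exists s => [n|p e cont_p e_gt0]; first by have [] := s_approx n.
set K := 13 * (hbar p x * (hbar p x ^+ 2 + 1) + 1).
have K_gt0 : 0 < K.
  by rewrite mulr_gt0 // ltr_wpDl // mulr_ge0 ?hbar_ge0 // addr_ge0 ?sqr_ge0.
have eK_gt0 : 0 < e / K by rewrite divr_gt0.
near=> n; rewrite hbarBC.
apply: (le_lt_trans ((s_approx n).2 p cont_p)); rewrite -/K mulrC -ltr_pdivlMr //.
by near: n; exact: (near_infty_natSinv_lt (PosNum eK_gt0)).
Unshelve. all: by end_near. Qed.

End Density.

(** * Unitary equivalence *)

Section UnitaryEquivalence.
Variables (R : realType) (A : locCstarAlgType R).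
Implicit Types E F : hilbertModType A.

Lemma is_adjoint_module_hom E F (U : E -> F) (V : F -> E) :
  is_adjoint [set: E] [set: F] U V ->
  module_hom [set: A] [set: E] [set: F] U.
Proof.
move=> [_ adjUV].
have {}adjUV x y : inner (U x) y = inner x (V y) by exact: adjUV.
by split=> // [x y|c x|x a] *; apply: eq_inner => z;
  rewrite ?innerDl ?innerZl ?inner_ractl !adjUV ?innerDl ?innerZl ?inner_ractl.
Qed.

Lemma mod_bounded_elts_inner E F (x : E) (y : F) :
  inner x x = inner y y -> mod_bounded_elts E x -> mod_bounded_elts F y.
Proof.
move=> eq_xy; rewrite /mod_bounded_elts /mod_norm_infty /=.
suff -> : [set (hbar p x)%:E | p in cont_seminorms (A := A)] =
          [set (hbar p y)%:E | p in cont_seminorms (A := A)] by [].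
by apply: eq_imagel => p _; rewrite /hbar eq_xy.
Qed.

Lemma unitarily_equivalent_bounded E F :
  unitarily_equivalent [set: A] [set: E] [set: F] ->
  unitarily_equivalent (bounded_elts A) (mod_bounded_elts E) (mod_bounded_elts F).
Proof.
move=> [U [[[_ UD UZ Ur] _] [V [[_ adjUV] VK UK]]]].
have U_bd x : mod_bounded_elts E x -> mod_bounded_elts F (U x).
  by apply: mod_bounded_elts_inner; rewrite adjUV // VK.
have V_bd y : mod_bounded_elts F y -> mod_bounded_elts E (V y).
  by apply: mod_bounded_elts_inner; rewrite -adjUV // UK.
have adj_bd : is_adjoint (mod_bounded_elts E) (mod_bounded_elts F) U V.
  by split=> // x y _ _; exact: adjUV.
exists U; split; first split.
- by split=> // [x y _ _|c x _|x a _ _]; [exact: UD | exact: UZ | exact: Ur].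
- by exists V.
- by exists V; split=> // [x _|y _]; [exact: VK | exact: UK].
Qed.

(** One seminorm at a time is enough, since equalities in A are tested by single seminorms. As a
    relation it can be read in both directions, so it also serves for the inverse. *)
Definition graph_closure E F (U : E -> F) (x : E) (y : F) : Prop :=
  forall (p : A -> R) (e : R), cont_seminorms p -> 0 < e ->
  exists x', [/\ mod_bounded_elts E x', hbar p (x - x') < e &
                 hbar p (y - U x') < e].

Section Extension.
Variables (E F : hilbertModType A) (U : E -> F).
Hypothesis U_inner : forall x x', mod_bounded_elts E x ->
  mod_bounded_elts E x' -> inner (U x) (U x') = inner x x'.

Lemma graph_closure_total x : exists y, graph_closure U x y.
Proof.
have [s s_bd s_x] := mod_bounded_dense x.
have [|y s_y] := @hilbert_seq_complete _ _ F (U \o s).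
  move=> p cont_p; have hp := cont_p.1.
  exists (fun n => 13 * hbar p (s n - x)) => [e e_gt0|m n /=].
    have e13_gt0 : 0 < e / 13 by rewrite divr_gt0.
    by apply: filterS (s_x p _ cont_p e13_gt0) => n; rewrite ltr_pdivlMr // mulrC.
  have -> : hbar p (U (s m) - U (s n)) = hbar p (s m - s n).
    by rewrite /hbar !inner_expand !U_inner.
  by rewrite -mulrDr (hbarBC _ (s n)) hbar_triangle.
exists y => p e cont_p e_gt0; near \oo => n; exists (s n); split=> //.
  by rewrite hbarBC; near: n; exact: s_x.
by rewrite hbarBC; near: n; exact: s_y.
Unshelve. all: by end_near. Qed.

Lemma inner_graph_closure x x' y y' : graph_closure U x y ->
  graph_closure U x' y' -> inner y y' = inner x x'.
Proof.
move=> xy x'y'; apply/eqP; rewrite -subr_eq0; apply/eqP.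
apply: cont_seminorms_eq0 => p cont_p; have hp := cont_p.1.
set D := p _; have D_ge0 : 0 <= D by exact: (cseminorm_ge0 hp).
(* Cauchy-Schwarz on the four terms of [eq_D]; two of them involve
   [hbar p u <= 13 * (hbar p x + 1)], whence 26. *)
pose K := 81 * (hbar p y' + 26 * (hbar p x + 1) + hbar p x').
have K_ge0 : 0 <= K.
  by rewrite mulr_ge0 // !addr_ge0 ?mulr_ge0 ?addr_ge0 ?hbar_ge0.
have le_D e : 0 < e -> e <= 1 -> D <= e * K.
  move=> e_gt0 e_le1; have e_ge0 := ltW e_gt0.
  have [u [u_bd xu yu]] := xy p e cont_p e_gt0.
  have [u' [u'_bd xu' yu']] := x'y' p e cont_p e_gt0.
  have eq_D : inner y y' - inner x x' =
      (inner (y - U u) y' + inner (U u) (y' - U u')) -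
      (inner (x - u) x' + inner u (x' - u')).
    by rewrite !inner_expand U_inner //; lmodule_eq R[i] A; ring.
  have eq_u : hbar p (U u) = hbar p u by rewrite /hbar U_inner.
  have u_le : hbar p u <= 13 * (hbar p x + 1).
    have := hbarD hp x (u - x); rewrite addrC subrK hbarBC; lra.
  have := cseminormB hp (inner (y - U u) y' + inner (U u) (y' - U u'))
                        (inner (x - u) x' + inner u (x' - u')).
  rewrite -eq_D -/D.
  have := cseminormD hp (inner (y - U u) y') (inner (U u) (y' - U u')).
  have := cseminormD hp (inner (x - u) x') (inner u (x' - u')).
  have := hbar_cauchy_schwarz hp (y - U u) y'.
  have := hbar_cauchy_schwarz hp (U u) (y' - U u').
  have := hbar_cauchy_schwarz hp (x - u) x'.
  have := hbar_cauchy_schwarz hp u (x' - u').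
  rewrite eq_u.
  have := ler_pM (hbar_ge0 p _) (hbar_ge0 p _) (ltW yu) (lexx (hbar p y')).
  have := ler_pM (hbar_ge0 p _) (hbar_ge0 p _) (ltW xu) (lexx (hbar p x')).
  have := ler_pM (hbar_ge0 p _) (hbar_ge0 p _) u_le (ltW yu').
  have := ler_pM (hbar_ge0 p _) (hbar_ge0 p _) u_le (ltW xu').
  rewrite /K; lra.
apply/le_anti; rewrite D_ge0 andbT leNgt; apply/negP => D_gt0.
have d_gt0 : 0 < D + K + 1 by lra.
have := le_D (D / (D + K + 1)); rewrite divr_gt0 // ler_pdivrMr // => /(_ isT).
have -> : D <= 1 * (D + K + 1) by lra.
move/(_ isT); rewrite mulrAC ler_pdivlMr // ler_pM2l //; lra.
Qed.

End Extension.

Lemma unitarily_equivalent_of_bounded E F :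
  unitarily_equivalent (bounded_elts A) (mod_bounded_elts E) (mod_bounded_elts F) ->
  unitarily_equivalent [set: A] [set: E] [set: F].
Proof.
move=> [U [[[U_bd _ _ _] _] [V [[V_bd adjUV] VK UK]]]].
have U_inner x x' : mod_bounded_elts E x -> mod_bounded_elts E x' ->
    inner (U x) (U x') = inner x x'.
  by move=> x_bd x'_bd; rewrite adjUV ?VK //; exact: U_bd.
have V_inner y y' : mod_bounded_elts F y -> mod_bounded_elts F y' ->
    inner (V y) (V y') = inner y y'.
  by move=> y_bd y'_bd; rewrite -adjUV ?UK //; exact: V_bd.
have /choice[U' U'P] : forall x, exists y, graph_closure U x y.
  exact: graph_closure_total.
(* The closure of the graph of V, reversed, lies in that of U, because U (V y') = y' on bounded
   elements. *)
have /choice[V' V'P] : forall y, exists x, graph_closure U x y.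
  move=> y; have [x xy] := graph_closure_total V_inner y.
  exists x => p e cont_p e_gt0; have [y' [y'_bd yy' xy']] := xy p e cont_p e_gt0.
  by exists (V y'); split; rewrite ?UK //; exact: V_bd.
(* Applied to the pairs (x, U' x) and (V' y, y), this gives adjointness; the inverse laws follow by
   testing against all z. *)
have graph_inner := inner_graph_closure U_inner.
have adj : is_adjoint [set: E] [set: F] U' V'.
  by split=> // x y _ _; exact: graph_inner.
exists U'; split; first by split; [exact: is_adjoint_module_hom adj | exists V'].
exists V'; split=> // [x _|y _]; apply: eq_inner => z.
  by rewrite -(graph_inner _ _ _ _ (V'P (U' x)) (U'P z)); exact: graph_inner.
rewrite (graph_inner _ _ _ _ (U'P (V' y)) (V'P z)).
by apply/esym; exact: graph_inner.
Qed.

End UnitaryEquivalence.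

Theorem corollary3p7 (R : realType) (A : locCstarAlgType R)
    (E F : hilbertModType A) :
  unitarily_equivalent [set: A] [set: E] [set: F] <->
  unitarily_equivalent (bounded_elts A) (mod_bounded_elts E) (mod_bounded_elts F).
Proof.
split; first exact: unitarily_equivalent_bounded.
exact: unitarily_equivalent_of_bounded.
Qed.
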